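(* Let $c>0$ and $x_0\in\mathbb{R}^3$. Let $k_{\mathrm{v}},k_{\mathrm{u}}$ be positive semidefinite functions on $\mathbb{R}^3\times\mathbb{R}^3$ such that the sample paths of the centered Gaussian process with covariance $k_{\mathrm{v}}$ (resp. $k_{\mathrm{u}}$) are continuous (resp. continuously differentiable), and which are radially symmetric around $x_0$: there are functions $k_{\mathrm{v}}^0,k_{\mathrm{u}}^0$ on $\mathbb{R}_+\times\mathbb{R}_+$ such that $$k_{\mathrm{v}}(x,x')=k_{\mathrm{v}}^0(r^2,r'^2),\qquad k_{\mathrm{u}}(x,x')=k_{\mathrm{u}}^0(r^2,r'^2),\qquad r=|x-x_0|,\ r'=|x'-x_0|.$$ Set $K_{\mathrm{v}}(r,r')=\int_0^r\int_0^{r'}k_{\mathrm{v}}^0(s,s')\,ds'\,ds$ for $r,r'\ge 0$. Then for all $z=(x,t)\in\mathbb{R}^3\times\mathbb{R}$ and $z'=(x',t')\in\mathbb{R}^3\times\mathbb{R}$ with $r=|x-x_0|\ne0$ and $r'=|x'-x_0|\neq 0$, $$k_{\mathrm{v}}^{\mathrm{wave}}(z,z')=\frac{\mathrm{sgn}(tt')}{16c^2rr'}\sum_{\varepsilon,\varepsilon'\in\{-1,1\}}\varepsilon\varepsilon' K_{\mathrm{v}}\big((r+\varepsilon c|t|)^2,(r'+\varepsilon' c|t'|)^2\big),$$ $$k_{\mathrm{u}}^{\mathrm{wave}}(z,z')=\frac{1}{4rr'}\sum_{\varepsilon,\varepsilon'\in\{-1,1\}}(r+\varepsilon c|t|)(r'+\varepsilon'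 c|t'|)\,k_{\mathrm{u}}^0\big((r+\varepsilon c|t|)^2,(r'+\varepsilon' c|t'|)^2\big),$$ where $k_{\mathrm{v}}^{\mathrm{wave}}(z,z')=[(F_t\otimes F_{t'})*k_{\mathrm{v}}](x,x')$ and $k_{\mathrm{u}}^{\mathrm{wave}}(z,z')=[(\dot F_t\otimes\dot F_{t'})*k_{\mathrm{u}}](x,x')$.
   Context: Positive semidefinite functions $k$ are symmetric, and such that $(k(x_i,x_j))_{i,j}$ is a symmetric nonnegative definite matrix for all finite families of points $(x_i)$. $S$ is the unit sphere of $\mathbb{R}^3$, $d\Omega$ its surface measure, $\gamma\in S$ the integration variable. For $t\ne0$, $F_t=\sigma_{c|t|}/(4\pi c^2t)$, where $\sigma_R$ is the surface measure of the sphere of center $0$ and radius $R$; equivalently, for all $t\in\mathbb{R}$ (with $F_0=0$), $\int f\,dF_t=t\int_S f(c|t|\gamma)\frac{d\Omega}{4\pi}$. Hence $$[(F_t\otimes F_{t'})*k](x,x')=tt'\int_S\int_S k(x-c|t|\gamma,x'-c|t'|\gamma')\frac{d\Omega}{4\pi}\frac{d\Omega'}{4\pi}.$$ $\dot F_t$ is the time derivative of $F_t$, i.e. the continuous linear form $\langle\dot F_t,\varphi\rangle=\partial_t\big(\int\varphi\,dF_t\big)$ on $C^1(\mathbb{R}^3)$, and $[(\dot F_t\otimes\dot F_{t'})*k_{\mathrm{u}}](x,x')=\partial_t\partial_{t'}\,[(F_t\otimes F_{t'})*k_{\mathrm{u}}](x,x')$. $\mathrm{sgn}$ is the sign function, with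 $\mathrm{sgn}(0)=0$. *)

(* Defs.v *)
From HB Require Import structures.
From mathcomp Require Import all_boot all_order all_algebra.
From mathcomp Require Import all_classical all_reals all_analysis.
Set Implicit Arguments.
Unset Strict Implicit.
Unset Printing Implicit Defensive.
Import Order.TTheory GRing.Theory Num.Theory.
Import numFieldNormedType.Exports.
Local Open Scope classical_set_scope.
Local Open Scope ring_scope.

Notation R3 R := 'rV[R]_3.

(* The library norm on 'rV[R]_3 is the sup norm, hence this definition; the
   topologies coincide. *)
Definition enorm (R : realType) (x : R3 R) : R :=
  Num.sqrt (\sum_i x 0 i ^+ 2).

Definition psd_fun (R : realType) (k : R3 R -> R3 R -> R) : Prop :=
  (forall x x', k x x' = k x' x) /\
  (forall (n : nat) (x : 'I_n -> R3 R) (a : 'I_n -> R),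
     0 <= \sum_i \sum_j a i * a j * k (x i) (x j)).

(* Constants count as Gaussian variables: the case s = 0, for which
   [normal_prob] takes an unrelated default value. *)
Definition gaussian_rv (R : realType) (d : measure_display)
    (T : measurableType d) (P : probability T R) (Y : T -> R) : Prop :=
  exists m s : R, 0 <= s /\
    forall A : set R, measurable A ->
      P (Y @^-1` A) = if s == 0 then \d_m A else normal_prob m s A.

Definition centered_gaussian_process (R : realType) (d : measure_display)
    (T : measurableType d) (P : probability T R)
    (k : R3 R -> R3 R -> R) (X : R3 R -> {RV P >-> R}) : Prop :=
  [/\ forall (n : nat) (x : 'I_n -> R3 R) (a : 'I_n -> R),
        gaussian_rv P (fun w => \sum_i a i * X (x i) w),
      forall x, ('E_P[X x] = 0)%E &
      forall x x', covariance P (X x) (X x') = (k x x')%:E].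

Definition C1 (R : realType) (f : R3 R -> R) : Prop :=
  (forall x, differentiable f x) /\ (forall v, continuous (fun x => 'D_v f x)).

(* "The" Gaussian process of covariance k is determined only in law; a property
   of its sample paths holds when some version has it almost surely. *)
Definition gaussian_paths (R : realType) (k : R3 R -> R3 R -> R)
    (reg : (R3 R -> R) -> Prop) : Prop :=
  exists (d : measure_display) (T : measurableType d) (P : probability T R)
         (X : R3 R -> {RV P >-> R}),
    centered_gaussian_process k X /\ {ae P, forall w, reg (fun x => X x w)}.

(* k0 is only meant on nonnegative arguments. *)
Definition radial (R : realType) (x0 : R3 R) (k : R3 R -> R3 R -> R)
    (k0 : R -> R -> R) : Prop :=
  forall x x', k x x' = k0 (enorm (x - x0) ^+ 2) (enorm (x' - x0) ^+ 2).

Definition sph (R : realType) (theta phi : R) : R3 R :=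
  \row_(i < 3) [:: sin theta * cos phi; sin theta * sin phi; cos theta]`_i.

(* Surface integral over the unit sphere, dOmega = sin theta dtheta dphi. *)
Definition sphere_int (R : realType) (f : R3 R -> R) : R :=
  \int[lebesgue_measure]_(theta in `[0, pi])
    (\int[lebesgue_measure]_(phi in `[0, 2 * pi])
      (f (sph theta phi) * sin theta)).

(* waveF c t f is the integral of f against the signed measure F_t. *)
Definition waveF (R : realType) (c t : R) (f : R3 R -> R) : R :=
  t * (sphere_int (fun gam => f ((c * `|t|) *: gam)) / (4 * pi)).

(* [(F_t (x) F_t') * k](x, x') *)
Definition waveFF (R : realType) (c t t' : R) (k : R3 R -> R3 R -> R)
    (x x' : R3 R) : R :=
  waveF c t (fun y => waveF c t' (fun y' => k (x - y) (x' - y'))).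

Definition kv_wave (R : realType) (c : R) (kv : R3 R -> R3 R -> R)
    (z z' : R3 R * R) : R :=
  waveFF c z.2 z'.2 kv z.1 z'.1.

(* d/dt d/dt' of waveFF. As [derive1] is total, [ku_wave_defined] records that
   the derivatives involved exist. *)
Definition ku_wave (R : realType) (c : R) (ku : R3 R -> R3 R -> R)
    (z z' : R3 R * R) : R :=
  derive1 (fun t : R => derive1 (fun t' : R => waveFF c t t' ku z.1 z'.1) z'.2)
    z.2.

Definition ku_wave_defined (R : realType) (c : R)
    (ku : R3 R -> R3 R -> R) (z z' : R3 R * R) : Prop :=
  (forall t : R,
     derivable (fun t' : R => waveFF c t t' ku z.1 z'.1) z'.2 1) /\
  derivable
    (fun t : R => derive1 (fun t' : R => waveFF c t t' ku z.1 z'.1) z'.2) z.2 1.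

Definition primitive2 (R : realType) (k0 : R -> R -> R) (r r' : R) : R :=
  \int[lebesgue_measure]_(s in `[0, r])
    (\int[lebesgue_measure]_(s' in `[0, r']) k0 s s').

(* Main.v *)
Require Import Defs.
From HB Require Import structures.
From mathcomp Require Import all_boot all_order all_algebra.
From mathcomp Require Import all_classical all_reals all_analysis.
From mathcomp Require Import measurable_realfun ring lra.
Import Order.TTheory GRing.Theory Num.Theory.
Import numFieldNormedType.Exports.
Local Open Scope classical_set_scope.
Local Open Scope ring_scope.

(** Let r = |x - x0| and let h be a continuous function.  On the sphere of
    center 0 and radius rho, |x - x0 - y|^2 = r^2 + rho^2 - 2 (x - x0).y, so the
    spherical mean of h(|x - x0 - y|^2) only involves the linear form (x - x0).y.
    By Archimedes' theorem, a linear form of norm r is uniformly distributed on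
    [-r, r] under the normalized surface measure ([sphere_int_ridge]).  Hence
    the mean is an ordinary integral, and with H an antiderivative of h
        int h(|x - x0 - y|^2) dF_t(y)
          = (H((r + ct)^2) - H((r - ct)^2)) / (4 c r)
    for every real t ([waveF_radial]): the right-hand side is odd in t, like the
    left-hand side.  Applying this in y' and then in y expresses the doubly
    convolved kernel by the double antiderivative of the radial profile
    ([waveFF_radial]).  The formula for k_v follows by separating signs and
    absolute values.  For k_u, that expression is differentiated in t' and
    then in t by the fundamental theorem of calculus: H is composed with
    (r + ct)^2, whose derivative 2c(r + ct) provides the factors of the formula.

    Everything thus rests on the continuity of the profiles.  Continuous sample
    paths give it as follows ([gaussian_kernel_continuous]): increments X_s - X_t
    tend to 0 almost surely, and for Gaussian variables this forces the variances
    to tend to 0 ([gaussian_variance_cvg]).  The Cauchy-Schwarz inequality for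
    positive semidefinite kernels then makes the covariance jointly continuous.

    In Archimedes' theorem, spherical coordinates only make the case of a vertical
    linear form immediate.  The general case is reduced to it by rotating the form
    and showing that the derivative of the integral in the rotation angle
    vanishes: the infinitesimal rotation is tangent to the sphere and
    divergence free, so the derivative of the integrand is a divergence in the
    coordinates (theta, phi) ([rotated_int_cst]). *)

(** * Pointwise continuity and derivation rules *)

Section Calculus.
Context {R : realType}.

Lemma continuousM_fun (T : topologicalType) (f g : T -> R) :
  continuous f -> continuous g -> continuous (fun x => f x * g x).
Proof. by move=> cf cg x; apply: cvgM; [exact: cf|exact: cg]. Qed.

Lemma continuousD_fun (T : topologicalType) (f g : T -> R) :
  continuous f -> continuous g -> continuous (fun x => f x + g x).
Proof. by move=> cf cg x; apply: cvgD; [exact: cf|exact: cg]. Qed.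

Lemma continuousN_fun (T : topologicalType) (f : T -> R) :
  continuous f -> continuous (fun x => - f x).
Proof. by move=> cf x; apply: cvgN; exact: cf. Qed.

Lemma continuous_comp_fun (T U V : topologicalType) (g : U -> V) (f : T -> U) :
  continuous g -> continuous f -> continuous (fun x => g (f x)).
Proof. by move=> cg cf x; apply: continuous_comp; [exact: cf|exact: cg]. Qed.

Lemma continuous_fst_fun (T U V : topologicalType) (f : T -> U * V) :
  continuous f -> continuous (fun x => (f x).1).
Proof. by move=> cf x; apply: (cvg_comp _ _ (cf x)); exact: cvg_fst. Qed.

Lemma continuous_snd_fun (T U V : topologicalType) (f : T -> U * V) :
  continuous f -> continuous (fun x => (f x).2).
Proof. by move=> cf x; apply: (cvg_comp _ _ (cf x)); exact: cvg_snd. Qed.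

Lemma continuous_pair_fun (T U V : topologicalType) (f : T -> U) (g : T -> V) :
  continuous f -> continuous g -> continuous (fun x => (f x, g x)).
Proof. by move=> cf cg x; apply: cvg_pair; [exact: cf|exact: cg]. Qed.

Lemma is_deriveM_fun (f g : R -> R) (x df dg : R) :
  is_derive x 1 f df -> is_derive x 1 g dg ->
  is_derive x 1 (fun x => f x * g x) (f x * dg + g x * df).
Proof. by move=> Df Dg; exact: is_deriveM. Qed.

Lemma is_deriveN_fun (f : R -> R) (x df : R) :
  is_derive x 1 f df -> is_derive x 1 (fun x => - f x) (- df).
Proof. by move=> Df; exact: is_deriveN. Qed.

Lemma is_derive_comp_fun (g f : R -> R) (x df dg : R) :
  is_derive (f x) 1 g dg -> is_derive x 1 f df ->
  is_derive x 1 (fun x => g (f x)) (dg * df).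
Proof. by move=> Dg Df; exact: is_derive1_comp. Qed.

Lemma is_derive_continuous (f df : R -> R) :
  (forall x : R, is_derive x 1 f (df x)) -> continuous f.
Proof.
by move=> dF x; apply: differentiable_continuous; apply/derivable1_diffP.
Qed.

End Calculus.

(** The cases of a bare [sin], [cos], [fst], [snd] or [GRing.mul _] are the
    eta-contracted forms of subterms that remain after the other cases. *)
Ltac cont := match goal with
  | H : continuous ?f |- continuous ?f => exact: H
  | |- continuous (fun=> ?c) => exact: cst_continuous
  | |- continuous (fun x => x) => by move=> ?; exact: cvg_id
  | |- continuous (GRing.mul _) =>
      by move=> ?; apply: cvgM; [exact: cvg_cst|exact: cvg_id]
  | |- continuous sin => exact: continuous_sin
  | |- continuous cos => exact: continuous_cos
  | |- continuous fst => by move=> ?; exact: cvg_fst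
  | |- continuous snd => by move=> ?; exact: cvg_snd
  | |- continuous (fun x => _ + _) => apply: continuousD_fun; cont
  | |- continuous (fun x => - _) => apply: continuousN_fun; cont
  | |- continuous (fun x => _ * _) => apply: continuousM_fun; cont
  | |- continuous (fun x => _.1) => apply: continuous_fst_fun; cont
  | |- continuous (fun x => _.2) => apply: continuous_snd_fun; cont
  | |- continuous (fun x => sin _) =>
      apply: (continuous_comp_fun _ _ _ sin); [exact: continuous_sin|cont]
  | |- continuous (fun x => cos _) =>
      apply: (continuous_comp_fun _ _ _ cos); [exact: continuous_cos|cont]
  | H : continuous ?g |- continuous (fun x => ?g _) =>
      apply: (continuous_comp_fun _ _ _ g); [exact: H|cont]
  end.

Ltac deriv_ring := apply: is_derive_eq => /=; rewrite /GRing.scale/=; ring.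

(** * Integrals of continuous functions depending on a parameter *)

Section Integrals.
Context {R : realType}.
Implicit Types (a b x : R) (f F : R -> R).
Local Notation mu := (@lebesgue_measure R).

Lemma continuous_integrable a b f : continuous f ->
  mu.-integrable `[a, b] (EFin \o f).
Proof.
move=> cf; apply: continuous_compact_integrable; first exact: segment_compact.
exact: continuous_subspaceT.
Qed.

Lemma Rintegral_FTC2 a b f F : a <= b -> continuous f ->
  (forall x, is_derive x 1 F (f x)) ->
  \int[mu]_(x in `[a, b]) f x = F b - F a.
Proof.
rewrite le_eqVlt => /predU1P[-> _ _|ab cf dF].
  by rewrite set_itv1 Rintegral_set1 subrr.
have cF : continuous F.
  by move=> x; apply: differentiable_continuous; apply/derivable1_diffP.
rewrite /Rintegral (continuous_FTC2 (F := F) ab)//.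
- exact: continuous_subspaceT.
- split=> [x _| |].
  + exact: ex_derive.
  + exact/cvg_at_right_filter/cF.
  + exact/cvg_at_left_filter/cF.
- by move=> x _; rewrite derive1E; exact: derive_val.
Qed.

(** The second integral makes this an antiderivative on the whole line; the
    derivative at 0 is needed because (r - ct)^2 may vanish. *)
Definition antideriv f x : R :=
  \int[mu]_(s in `[0, x]) f s - \int[mu]_(s in `[x, 0]) f s.

Lemma antideriv_ge0 f x : 0 <= x -> antideriv f x = \int[mu]_(s in `[0, x]) f s.
Proof.
rewrite /antideriv le_eqVlt => /predU1P[<-|x0].
  by rewrite set_itv1 Rintegral_set1 subrr.
by rewrite (@set_itv_ge _ _ (BLeft x)) ?Rintegral_set0 ?subr0// bnd_simp -ltNge.
Qed.

Lemma Rintegral_chasles f a b x : a <= b -> b <= x -> continuous f ->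
  \int[mu]_(s in `[a, x]) f s =
  \int[mu]_(s in `[a, b]) f s + \int[mu]_(s in `[b, x]) f s.
Proof.
move=> ab bx cf.
have := @Rintegral_itvB R f (BLeft a) (BRight x) b.
rewrite !bnd_simp => /(_ (continuous_integrable a x _ cf) ab bx).
rewrite Rintegral_itv_obnd_cbnd; first by move=> <-; rewrite addrC subrK.
apply: integrableS (continuous_integrable b x _ cf) => //.
exact: subset_itv_oc_cc.
Qed.

Lemma antideriv_shift f a x : a <= 0 -> a <= x -> continuous f ->
  antideriv f x = \int[mu]_(s in `[a, x]) f s - \int[mu]_(s in `[a, 0]) f s.
Proof.
move=> a0 ax cf; have [x0|x0] := leP 0 x.
  by rewrite (antideriv_ge0 _ _ x0) (Rintegral_chasles _ _ _ _ a0 x0 cf) addrC addKr.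
rewrite /antideriv (@set_itv_ge _ _ (BLeft 0)); last by rewrite bnd_simp -ltNge.
by rewrite Rintegral_set0 sub0r (Rintegral_chasles _ _ _ _ ax (ltW x0) cf) opprD
  addrA subrr sub0r.
Qed.

Lemma is_derive_antideriv f x : continuous f -> is_derive x 1 (antideriv f) (f x).
Proof.
move=> cf; pose a := Num.min x 0 - 1.
have ax : a < x by rewrite /a ltrBlDr gt_min ltrDl ltr01.
have a0 : a <= 0 by rewrite /a lerBlDr ge_min lerDl ler01 orbT.
have x1 : x < x + 1 by rewrite ltrDl.
have [dF F'] := continuous_FTC1_closed x1 (continuous_integrable a (x + 1) _ cf) ax (cf x).
pose F y := \int[mu]_(s in `[a, y]) f s - \int[mu]_(s in `[a, 0]) f s.
have DF : is_derive x 1 F (f x).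
  rewrite -[X in is_derive _ _ _ X]subr0 -F' derive1E.
  by apply: is_deriveB; exact/derivableP.
apply: near_eq_is_derive DF; near=> y; apply/esym/antideriv_shift => //.
by apply: ltW; near: y; exact: lt_nbhsr.
Unshelve. all: end_near. Qed.

Lemma continuous_slice (T : topologicalType) (h : T -> R -> R) (t : T) :
  continuous (fun p : T * R => h p.1 p.2) -> continuous (h t).
Proof.
move=> ch y; apply: (@continuous_comp _ _ _ (fun y => (t, y)) (fun p => h p.1 p.2)).
  exact: (cvg_pair (cvg_cst t) cvg_id).
exact: ch.
Qed.

(** The tube lemma on the compact segment [a, b]. *)
Lemma continuous_unif_segment (T : topologicalType) (h : T -> R -> R) (t : T)
    (a b e : R) : continuous (fun p : T * R => h p.1 p.2) -> 0 < e ->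
  \forall u \near t, forall y, y \in `[a, b] -> `|h t y - h u y| < e.
Proof.
move=> ch e0.
have /compact_near_coveringP cov := @segment_compact R a b.
have := cov T (nbhs t) (fun u y => `|h t y - h u y| < e) _; apply=> y _.
have /cvgrPdist_lt/(_ (e / 2)) := ch (t, y); rewrite divr_gt0// => /(_ isT) /= H1.
have /cvgrPdist_lt/(_ (e / 2)) := continuous_slice _ h t ch y.
rewrite divr_gt0// => /(_ isT) /= H2.
case: H1 => [[U V] /= [tU yV] UV].
near=> z u => /=.
have E1 : `|h t y - h u z| < e / 2.
  by apply: (UV (u, z)); split => /=; [near: u|near: z].
have E2 : `|h t y - h t z| < e / 2 by near: z.
rewrite (_ : h t z - h u z = (h t y - h u z) - (h t y - h t z)); last by ring.
by rewrite (le_lt_trans (ler_normB _ _))// [ltRHS]splitr ltrD.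
Unshelve. all: end_near. Qed.

Lemma continuous_slice_r (h : R -> R -> R) (y : R) :
  continuous (fun p : R * R => h p.1 p.2) -> continuous (h ^~ y).
Proof.
move=> ch.
apply: (continuous_comp_fun _ _ _ (fun p : R * R => h p.1 p.2) (fun x => (x, y))) => //.
by apply: continuous_pair_fun; cont.
Qed.

Lemma ler_norm_Rintegral (a b e : R) f : a <= b -> continuous f ->
  (forall y, y \in `[a, b] -> `|f y| <= e) ->
  `|\int[mu]_(y in `[a, b]) f y| <= e * (b - a).
Proof.
move=> ab cf fe.
have ci := continuous_integrable a b.
apply: le_trans (le_normr_Rintegral _ (ci _ cf)) _ => //.
apply: le_trans (@le_Rintegral _ _ _ mu _ _ (cst e) _ _ _ _) _ => //.
- by apply: ci => y; apply: continuous_comp; [exact: cf|exact: norm_continuous].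
- by apply: ci => y; exact: cst_continuous.
- rewrite Rintegral_cst//= lebesgue_measure_itv/= lte_fin.
  by move: ab; rewrite le_eqVlt => /predU1P[->|->]//; rewrite ltxx subrr.
Qed.

Lemma continuous_Rintegral (T : topologicalType) (h : T -> R -> R) (a b : R) :
  a <= b -> continuous (fun p : T * R => h p.1 p.2) ->
  continuous (fun t => \int[mu]_(y in `[a, b]) h t y).
Proof.
move=> ab ch t; apply/cvgrPdist_le => e e0 /=.
have e'0 : 0 < e / (b - a + 1) by rewrite divr_gt0// ltr_wpDl// subr_ge0.
near=> u.
have chu v : continuous (h v) by exact: continuous_slice.
rewrite -RintegralB//; try exact: continuous_integrable.
apply: le_trans (ler_norm_Rintegral a b (e / (b - a + 1)) _ ab _ _) _.
- by move=> y; apply: cvgB; exact: chu.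
- move=> y yab; apply: ltW; move: y yab; near: u.
  exact: continuous_unif_segment.
- have b1 : 0 < b - a + 1 by rewrite ltr_wpDl// subr_ge0.
  by rewrite mulrAC ler_pdivrMr// ler_pM2l// lerDl.
Unshelve. all: end_near. Qed.

(** By the mean value theorem the difference quotient at y is a value dh z y
    with z close to x, and dh z y - dh x y is small uniformly in y. *)
Lemma is_derive_Rintegral (h dh : R -> R -> R) (a b x : R) : a <= b ->
  (forall x, continuous (h x)) ->
  (forall x y, is_derive x 1 (h^~ y) (dh x y)) ->
  continuous (fun p : R * R => dh p.1 p.2) ->
  is_derive x 1 (fun x => \int[mu]_(y in `[a, b]) h x y)
                (\int[mu]_(y in `[a, b]) dh x y).
Proof.
move=> ab ch dhE cdh; set F := (fun x => _).
have cdhx v : continuous (dh v) by exact: continuous_slice.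
have ci := continuous_integrable a b.
suff H : (fun d => d^-1 *: (F (d *: 1 + x) - F x)) @ 0^' -->
         \int[mu]_(y in `[a, b]) dh x y.
  by apply: DeriveDef; [apply/cvg_ex; eexists; exact: H|exact: cvg_lim H].
apply/cvgrPdist_le => e e0.
have b1 : 0 < b - a + 1 by rewrite ltr_wpDl// subr_ge0.
have e'0 : 0 < e / (b - a + 1) by rewrite divr_gt0.
have [r /= r0 xr] := continuous_unif_segment _ dh x a b _ cdh e'0.
near=> d.
have d0 : d != 0 by near: d; exact: nbhs_dnbhs_neq.
have dr : `|d| < r by near: d; apply: dnbhs0_lt.
have MV y : exists2 z, `|x - z| < r & h (d + x) y - h x y = d * dh z y.
  have hc : continuous (h^~ y).
    by move=> z; apply: differentiable_continuous; apply/derivable1_diffP.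
  have [d1|d1|d1] := ltgtP d 0; last by rewrite d1 eqxx in d0.
  - have dx : d + x <= x by rewrite gerDr ltW.
    have [|z zI zE] := @MVT_segment R (h^~ y) (dh^~ y) _ _ dx (fun z _ => dhE z y).
      exact: continuous_subspaceT.
    exists z; last by rewrite -opprB zE; ring.
    move: zI; rewrite in_itv/= => /andP[z1 z2]; rewrite ger0_norm ?subr_ge0//.
    by rewrite (le_lt_trans _ dr)// ltr0_norm//; lra.
  - have dx : x <= d + x by rewrite lerDr ltW.
    have [|z zI zE] := @MVT_segment R (h^~ y) (dh^~ y) _ _ dx (fun z _ => dhE z y).
      exact: continuous_subspaceT.
    exists z; last by rewrite zE; ring.
    move: zI; rewrite in_itv/= => /andP[z1 z2]; rewrite ler0_norm ?subr_le0//.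
    by rewrite (le_lt_trans _ dr)// gtr0_norm//; lra.
have chB : continuous (fun y => h (d + x) y - h x y).
  by move=> y; apply: cvgB; exact: ch.
have cq : continuous (fun y => d^-1 * (h (d + x) y - h x y)).
  by move=> y; apply: cvgM; [exact: cvg_cst|exact: chB].
rewrite /F scaler1 -RintegralB; [|by []|exact/ci/ch|exact/ci/ch].
rewrite -[_ *: _]/(_ * _) -RintegralZl; [|by []|exact: ci chB].
rewrite -RintegralB; [|by []|exact/ci/cdhx|exact: ci cq].
apply: le_trans (ler_norm_Rintegral a b (e / (b - a + 1)) _ ab _ _) _.
- by move=> y; apply: cvgB; [exact: cdhx|exact: cq].
- move=> y yab; have [z xz ->] := MV y; rewrite mulKf//.
  exact/ltW/xr.
- by rewrite mulrAC ler_pdivrMr// ler_pM2l// lerDl.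
Unshelve. all: end_near. Qed.

Lemma is_derive_Rintegral2 (h dh : R -> R -> R -> R) (a b a' b' x : R) :
  a <= b -> a' <= b' ->
  continuous (fun p : R * R * R => h p.1.1 p.1.2 p.2) ->
  (forall x y z : R, is_derive x 1 (fun x => h x y z) (dh x y z)) ->
  continuous (fun p : R * R * R => dh p.1.1 p.1.2 p.2) ->
  is_derive x 1
    (fun x => \int[mu]_(y in `[a, b]) \int[mu]_(z in `[a', b']) h x y z)
    (\int[mu]_(y in `[a, b]) \int[mu]_(z in `[a', b']) dh x y z).
Proof.
move=> ab ab' ch dhE cdh.
apply: (is_derive_Rintegral (fun x y => \int[mu]_(z in `[a', b']) h x y z)
  (fun x y => \int[mu]_(z in `[a', b']) dh x y z)) => //.
- move=> t; apply: continuous_Rintegral => //.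
  apply: (continuous_comp_fun _ _ _ (fun p => h p.1.1 p.1.2 p.2)
    (fun p : R * R => (t, p.1, p.2))); first exact: ch.
  by apply: continuous_pair_fun; [apply: continuous_pair_fun|]; cont.
- move=> t y; apply: (is_derive_Rintegral (fun x z => h x y z)
    (fun x z => dh x y z)) => //.
  + move=> v; apply: (continuous_slice _ (fun p => h p.1 p.2) (v, y)); exact: ch.
  + apply: (continuous_comp_fun _ _ _ (fun p => dh p.1.1 p.1.2 p.2)
      (fun p : R * R => (p.1, y, p.2))); first exact: cdh.
    by apply: continuous_pair_fun; [apply: continuous_pair_fun|]; cont.
- exact: (continuous_Rintegral _ (fun p => dh p.1 p.2)).
Qed.

Lemma antideriv_comb (f g : R -> R) (C x : R) : continuous f -> continuous g ->
  antideriv (fun s => C * (f s - g s)) x = C * (antideriv f x - antideriv g x).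
Proof.
move=> cf cg; have cfg : continuous (fun s => f s - g s) by cont.
rewrite /antideriv !RintegralZl ?RintegralB //; try exact: continuous_integrable.
by ring.
Qed.

Lemma continuous_antideriv_param (T : topologicalType) (h : T -> R -> R) (b : R) :
  continuous (fun p : T * R => h p.1 p.2) ->
  continuous (fun t => antideriv (h t) b).
Proof.
move=> ch; have [b0|b0] := leP 0 b.
  rewrite (_ : (fun t => _) = (fun t => \int[mu]_(y in `[0, b]) h t y)); last first.
    by apply/funext => t; exact: antideriv_ge0.
  exact: continuous_Rintegral.
rewrite (_ : (fun t => _) = (fun t => - \int[mu]_(y in `[b, 0]) h t y)).
  by apply: continuousN_fun; apply: continuous_Rintegral => //; exact: ltW.
apply/funext => t; rewrite /antideriv (@set_itv_ge _ _ (BLeft 0)).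
  by rewrite Rintegral_set0 sub0r.
by rewrite bnd_simp -ltNge.
Qed.

Definition antideriv2 (K : R -> R -> R) (a b : R) : R :=
  antideriv (fun s => antideriv (K s) b) a.

(** For a >= 0 the outer antiderivative is an integral over [0, a], and the
    derivative goes under it. *)
Lemma is_derive_antideriv2 (K : R -> R -> R) (a b : R) :
  continuous (fun p : R * R => K p.1 p.2) -> 0 <= a ->
  is_derive b 1 (antideriv2 K a) (antideriv (K ^~ b) a).
Proof.
move=> cK a0; rewrite /antideriv2 antideriv_ge0//.
rewrite (_ : (fun b => _) = (fun b => \int[mu]_(s in `[0, a]) antideriv (K s) b)); last first.
  by apply/funext => b'; exact: antideriv_ge0.
apply: (is_derive_Rintegral (fun b s => antideriv (K s) b) (fun b s => K s b)) => //.
- by move=> b'; exact: continuous_antideriv_param.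
- by move=> b' s; apply: is_derive_antideriv; exact: continuous_slice.
- apply: (continuous_comp_fun _ _ _ (fun p : R * R => K p.1 p.2) (fun p => (p.2, p.1))).
    exact: cK.
  by apply: continuous_pair_fun; cont.
Qed.

End Integrals.

(** * Integrals of ridge functions over the sphere *)

Section Sphere.
Context {R : realType}.
Local Notation mu := (@lebesgue_measure R).

(** The inner product of r (sin al u1, sin al u2, cos al) with the point of the unit
    sphere of spherical coordinates (th, phi). *)
Definition rotated_dot (r u1 u2 al th phi : R) : R :=
  r * (sin al * sin th * (u1 * cos phi + u2 * sin phi) + cos al * cos th).

Definition rotated_int (r u1 u2 : R) (g : R -> R) (al : R) : R :=
  \int[mu]_(th in `[0, pi]) \int[mu]_(phi in `[0, 2 * pi])
    (g (rotated_dot r u1 u2 al th phi) * sin th).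

Section Rotation.
Variables (r u1 u2 : R) (g dg : R -> R).
Hypothesis (u_unit : u1 ^+ 2 + u2 ^+ 2 = 1).
Hypothesis (dgE : forall x : R, is_derive x 1 g (dg x)) (cdg : continuous dg).

Let C (phi : R) := u1 * cos phi + u2 * sin phi.
Let S (phi : R) := u1 * sin phi - u2 * cos phi.
Let lin (al th phi : R) := rotated_dot r u1 u2 al th phi.

Let cg : continuous g := is_derive_continuous _ _ dgE.

Let CS1 phi : C phi ^+ 2 + S phi ^+ 2 = 1.
Proof.
transitivity ((u1 ^+ 2 + u2 ^+ 2) * (cos phi ^+ 2 + sin phi ^+ 2)).
  by rewrite /C /S; ring.
by rewrite u_unit cos2Dsin2 mulr1.
Qed.

(* [df] is the derivative of [f] in al, [dth] that of C (sin th) g(lin) in th,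
   and [dphi] that of (cos th) S g(lin) in phi. *)
Let f (al th phi : R) := g (lin al th phi) * sin th.
Let df (al th phi : R) :=
  dg (lin al th phi) * (r * (cos al * sin th * C phi - sin al * cos th)) * sin th.
Let dth (al th phi : R) := C phi * (cos th * g (lin al th phi) +
  sin th * (dg (lin al th phi) * (r * (sin al * cos th * C phi - cos al * sin th)))).
Let dphi (al th phi : R) := cos th * (C phi * g (lin al th phi) -
  S phi * (dg (lin al th phi) * (r * (sin al * sin th * S phi)))).

(* The derivative in al is the derivative along the infinitesimal rotation
   - C d_th + (cot th) S d_phi, which has divergence 0 for the surface measure
   (sin th) dth dphi. *)
Let dfE al th phi : df al th phi = dphi al th phi - dth al th phi.
Proof.
rewrite /df /dphi /dth.
transitivity (dg (lin al th phi) * r * sin th *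
    (cos al * sin th * C phi - sin al * cos th * (C phi ^+ 2 + S phi ^+ 2))).
  by rewrite CS1; ring.
by ring.
Qed.

Let pi2_ge0 : 0 <= 2 * pi :> R. Proof. by rewrite mulr_ge0// pi_ge0. Qed.

(* The flux of the th-part vanishes because sin th = 0 at both poles, that of
   the phi-part because phi is periodic. *)
Let rotated_int_derive0 (al : R) :
  \int[mu]_(th in `[0, pi]) \int[mu]_(phi in `[0, 2 * pi]) df al th phi = 0.
Proof.
pose W th := \int[mu]_(phi in `[0, 2 * pi]) (C phi * (sin th * g (lin al th phi))).
have cdth : continuous (fun p : R * R => dth al p.1 p.2).
  by rewrite /dth /lin /rotated_dot /C; cont.
have cdphi : continuous (fun p : R * R => dphi al p.1 p.2).
  by rewrite /dphi /lin /rotated_dot /S /C; cont.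
have dW (th : R) : is_derive th 1 W (\int[mu]_(phi in `[0, 2 * pi]) dth al th phi).
  apply: is_derive_Rintegral => //.
  - by move=> x; rewrite /lin /rotated_dot /C; cont.
  - move=> x phi; rewrite /dth /lin /rotated_dot /C; deriv_ring.
transitivity (\int[mu]_(th in `[0, pi]) - \int[mu]_(phi in `[0, 2 * pi]) dth al th phi).
  apply: eq_Rintegral => th _.
  under eq_Rintegral do rewrite dfE.
  rewrite RintegralB//; try by apply: continuous_integrable; exact: continuous_slice.
  have D (phi : R) : is_derive phi 1
      (fun phi => cos th * (S phi * g (lin al th phi))) (dphi al th phi).
    by rewrite /dphi /lin /rotated_dot /C /S; deriv_ring.
  rewrite (Rintegral_FTC2 _ _ _ _ pi2_ge0 _ D)//.
  - rewrite /lin /rotated_dot /S /C [2 * pi]mulr_natl sin2pi cos2pi sin0 cos0.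
    by rewrite subrr sub0r.
  - exact: continuous_slice.
have dNW (th : R) := is_deriveN_fun W th _ (dW th).
rewrite (Rintegral_FTC2 _ _ _ _ (pi_ge0 R) _ dNW).
- have W0 th : sin th = 0 -> W th = 0.
    move=> s0; rewrite /W; under eq_Rintegral do rewrite s0 mul0r mulr0.
    by rewrite Rintegral_cst// mul0r.
  by rewrite !W0 ?sin0 ?sinpi// subrr.
- by apply: continuousN_fun; exact: continuous_Rintegral.
Qed.

Lemma rotated_int_cst (al : R) : rotated_int r u1 u2 g al = rotated_int r u1 u2 g 0.
Proof.
apply: is_derive_0_is_cst => {}al.
rewrite -(rotated_int_derive0 al).
apply: (is_derive_Rintegral2 f df) => //; first exact: pi_ge0.
- by rewrite /f /lin /rotated_dot; cont.
- by move=> x th phi; rewrite /f /df /lin /rotated_dot /C; deriv_ring.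
- by rewrite /df /lin /rotated_dot /C; cont.
Qed.

(** For al = 0 the integrand does not depend on phi and has antiderivative
    - G(r cos th) / r in th. *)
Lemma rotated_int0 (G : R -> R) : (forall x : R, is_derive x 1 G (g x)) ->
  r * rotated_int r u1 u2 g 0 = 2 * pi * (G r - G (- r)).
Proof.
move=> dG; rewrite /rotated_int /rotated_dot.
have H th : \int[mu]_(phi in `[0, 2 * pi])
    (g (r * (sin 0 * sin th * (u1 * cos phi + u2 * sin phi) + cos 0 * cos th)) * sin th) =
    g (r * cos th) * sin th * (2 * pi).
  under eq_Rintegral do rewrite sin0 cos0 !mul0r add0r mul1r.
  rewrite Rintegral_cst//= lebesgue_measure_itv/= lte_fin.
  by rewrite mulr_gt0// ?pi_gt0//= subr0.
under eq_Rintegral do rewrite H.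
rewrite -RintegralZl//; last by apply: continuous_integrable; cont.
have D (th : R) : is_derive th 1 (fun th => - (2 * pi) * G (r * cos th))
    (r * (g (r * cos th) * sin th * (2 * pi))).
  by deriv_ring.
rewrite (Rintegral_FTC2 _ _ _ _ (pi_ge0 R) _ D).
- by rewrite cospi cos0 mulr1 mulrN1; ring.
- by cont.
Qed.

End Rotation.

Lemma rotated_int_C1 (r u1 u2 al : R) (G g dg : R -> R) :
  u1 ^+ 2 + u2 ^+ 2 = 1 ->
  (forall x : R, is_derive x 1 G (g x)) ->
  (forall x : R, is_derive x 1 g (dg x)) -> continuous dg ->
  r * rotated_int r u1 u2 g al = 2 * pi * (G r - G (- r)).
Proof.
by move=> u1E dG dgE cdg; rewrite (rotated_int_cst _ _ _ _ dg)//
  (rotated_int0 _ _ _ _ dg _ G).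
Qed.

(** A continuous g is the derivative of a C^1 function G.  The identity for the
    translates G(s + .), differentiated in s at 0, is the identity for g. *)
Lemma rotated_int_continuous (r u1 u2 al : R) (G g : R -> R) :
  u1 ^+ 2 + u2 ^+ 2 = 1 ->
  (forall x : R, is_derive x 1 G (g x)) -> continuous g ->
  r * rotated_int r u1 u2 g al = 2 * pi * (G r - G (- r)).
Proof.
move=> uE dG cg.
have cG : continuous G := is_derive_continuous _ _ dG.
have dH (x : R) : is_derive x 1 (antideriv G) (G x) by exact: is_derive_antideriv.
set H := antideriv G in dH.
pose L (s : R) := r * rotated_int r u1 u2 (fun x => G (s + x)) al.
have LE s : L s = 2 * pi * (H (s + r) - H (s + - r)).
  rewrite /L.
  have D1 (x : R) : is_derive x 1 (fun x => H (s + x)) (G (s + x)) by deriv_ring.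
  have D2 (x : R) : is_derive x 1 (fun x => G (s + x)) (g (s + x)) by deriv_ring.
  have cgs : continuous (fun x => g (s + x)).
    move=> x; apply: continuous_comp; last exact: cg.
    by apply: cvgD; [exact: cvg_cst|exact: cvg_id].
  by rewrite (rotated_int_C1 _ _ _ _ _ _ _ uE D1 D2 cgs).
have dL1 : is_derive (0 : R) 1 L (2 * pi * (G (0 + r) - G (0 + - r))).
  by rewrite (funext LE); deriv_ring.
have dL2 : is_derive (0 : R) 1 L (r * rotated_int r u1 u2 (fun x => g (0 + x)) al).
  have := is_derive_Rintegral2
    (fun s th phi => G (s + rotated_dot r u1 u2 al th phi) * sin th)
    (fun s th phi => g (s + rotated_dot r u1 u2 al th phi) * sin th)
    0 pi 0 (2 * pi) 0 (pi_ge0 R).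
  rewrite mulr_ge0 ?pi_ge0// => /(_ isT) D.
  have D' : is_derive (0 : R) 1
      (fun s : R => rotated_int r u1 u2 (fun x : R => G (s + x)) al)
      (rotated_int r u1 u2 (fun x => g (0 + x)) al).
    apply: D.
    + by rewrite /rotated_dot; cont.
    + by move=> x th phi; rewrite /rotated_dot; deriv_ring.
    + by rewrite /rotated_dot; cont.
  have := is_deriveM_fun (fun=> r) _ _ _ _ (is_derive_cst r _ _) D'.
  by rewrite mulr0 addr0.
have := @derive_val _ _ _ _ _ _ _ dL2.
rewrite (@derive_val _ _ _ _ _ _ _ dL1) !add0r => ->.
have -> : (fun x : R => g (0 + x)) = g by apply/funext => x; rewrite add0r.
by [].
Qed.

Lemma unit_direction (a b p : R) : 0 <= p -> p ^+ 2 = a ^+ 2 + b ^+ 2 ->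
  exists u1 u2, [/\ u1 ^+ 2 + u2 ^+ 2 = 1, a = p * u1 & b = p * u2].
Proof.
rewrite le_eqVlt => /predU1P[<-|p0 pE].
  rewrite expr0n/= => /esym/eqP; rewrite paddr_eq0 ?sqr_ge0// !sqrf_eq0.
  move=> /andP[/eqP-> /eqP->]; exists 1, 0.
  by rewrite expr1n expr0n addr0 !mul0r.
exists (a / p), (b / p); split; last 2 first.
- by rewrite mulrC divfK// gt_eqF.
- by rewrite mulrC divfK// gt_eqF.
by rewrite !expr_div_n -mulrDl -pE divff// expf_neq0// gt_eqF.
Qed.

Lemma sqr_enorm (y : R3 R) :
  enorm y ^+ 2 = y 0 0 ^+ 2 + y 0 1 ^+ 2 + y 0 (inord 2) ^+ 2.
Proof.
rewrite /enorm sqr_sqrtr; last by apply: sumr_ge0 => i _; exact: sqr_ge0.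
rewrite !big_ord_recl big_ord0 addr0 addrA.
by congr (y 0 _ ^+ 2 + y 0 _ ^+ 2 + y 0 _ ^+ 2); apply/val_inj; rewrite /= ?inordK.
Qed.

Lemma sph_coordinates (y : R3 R) : exists al u1 u2, [/\ u1 ^+ 2 + u2 ^+ 2 = 1,
  y 0 0 = enorm y * sin al * u1, y 0 1 = enorm y * sin al * u2 &
  y 0 (inord 2) = enorm y * cos al].
Proof.
have := sqr_enorm y; set r := enorm y => rE.
have : 0 <= r by exact: sqrtr_ge0.
rewrite le_eqVlt => /predU1P[r0|r0].
  move: rE; rewrite -r0 expr0n/= => /esym/eqP.
  rewrite !paddr_eq0 ?sqr_ge0 ?addr_ge0 ?sqr_ge0// !sqrf_eq0.
  move=> /andP[/andP[/eqP-> /eqP->] /eqP->]; exists 0, 1, 0.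
  by rewrite expr1n expr0n addr0 !mul0r.
have dr : -1 <= y 0 (inord 2) / r <= 1.
  rewrite -ler_norml normrM normfV (gtr0_norm r0) ler_pdivrMr// mul1r.
  rewrite -(@ler_pXn2r _ 2) ?nnegrE ?normr_ge0 ?(ltW r0)// real_normK ?num_real//.
  by rewrite rE lerDr addr_ge0 ?sqr_ge0.
pose al := acos (y 0 (inord 2) / r).
have cE : cos al = y 0 (inord 2) / r by rewrite acosK// in_itv.
have s0 : 0 <= sin al by rewrite sin_acos ?sqrtr_ge0.
have rcE : r * cos al = y 0 (inord 2) by rewrite cE mulrC divfK ?gt_eqF.
have [||u1 [u2 [uE aE bE]]] := @unit_direction (y 0 0) (y 0 1) (r * sin al).
- by rewrite mulr_ge0// ltW.
- have := cos2Dsin2 al => /(canRL (addKr _)) sE.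
  rewrite exprMn sE; transitivity (r ^+ 2 - (r * cos al) ^+ 2); first by ring.
  by rewrite rcE rE; ring.
by exists al, u1, u2; split.
Qed.

(** Archimedes' theorem: under the surface measure of the unit sphere, the linear
    form of vector y is uniformly distributed on [- |y|, |y|].  The factor |y| on
    the left covers y = 0. *)
Lemma sphere_int_ridge (y : R3 R) (G g : R -> R) :
  (forall x : R, is_derive x 1 G (g x)) -> continuous g ->
  enorm y * sphere_int (fun gam => g (\sum_i y 0 i * gam 0 i)) =
  2 * pi * (G (enorm y) - G (- enorm y)).
Proof.
move=> dG cg; have [al [u1 [u2 [uE y0 y1 y2]]]] := sph_coordinates y.
rewrite -(rotated_int_continuous (enorm y) u1 u2 al _ _ uE dG cg).
congr (_ * _); apply: eq_Rintegral => th _; apply: eq_Rintegral => phi _.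
congr (g _ * _).
rewrite !big_ord_recl big_ord0 addr0 !mxE /rotated_dot /=.
have -> : lift ord0 ord0 = 1 :> 'I_3 by exact/val_inj.
have -> : lift ord0 (lift ord0 ord0) = inord 2 :> 'I_3.
  by apply/val_inj; rewrite /= inordK.
rewrite y0 y1 y2; ring.
Qed.

End Sphere.

(** * Second moments of normal variables *)

Section Gaussian.
Context {R : realType}.
Local Notation mu := (@lebesgue_measure R).

Lemma ge0_integral_normal_prob (m s : R) (f : R -> \bar R) :
  measurable_fun setT f -> (forall x, (0 <= f x)%E) ->
  (\int[normal_prob m s]_x f x = \int[mu]_x (f x * (normal_pdf m s x)%:E))%E.
Proof.
move=> mf f0; have dom := normal_prob_dominates m s.
rewrite -(Radon_Nikodym_SigmaFinite.change_of_variables dom)//.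
have intd := Radon_Nikodym_SigmaFinite.f_integrable dom.
have mpdf : measurable_fun setT (fun x => (normal_pdf m s x)%:E).
  by apply/measurable_EFinP; exact: measurable_normal_pdf.
apply: ae_eq_integral => //.
- by apply: emeasurable_funM => //; exact: measurable_int intd.
- exact: emeasurable_funM.
- apply: ae_eqe_mul2l; apply: integral_ae_eq => //.
  by move=> E _ mE; rewrite -(Radon_Nikodym_SigmaFinite.f_integral dom).
Qed.

Lemma normal_fun_pdf (m s x : R) : s != 0 ->
  normal_fun m s x = (normal_peak s)^-1 * normal_pdf m s x.
Proof.
move=> s0; rewrite normal_pdfE// mulKf//.
by rewrite gt_eqF// normal_peak_gt0.
Qed.

Lemma normal_peakE (s : R) : 0 < s -> normal_peak s = s^-1 * normal_peak 1.
Proof.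
move=> s0; rewrite /normal_peak expr1n mul1r -mulrnAr sqrtrM ?sqr_ge0//.
by rewrite sqrtr_sqr gtr0_norm// invfM.
Qed.

(** The density of N(m, s^2) is at most [normal_peak s], and the integral of
    [normal_fun 0 tau] is 1 / [normal_peak tau]. *)
Lemma gaussian_test_le (m s tau : R) : 0 < s -> 0 < tau ->
  (\int[normal_prob m s]_x (normal_fun 0 tau x)%:E <= (tau / s)%:E)%E.
Proof.
move=> s0 t0.
rewrite ge0_integral_normal_prob//; last 2 first.
- by apply/measurable_EFinP; exact: measurable_normal_fun.
- by move=> x; rewrite lee_fin normal_fun_ge0.
apply: (@le_trans _ _ (\int[mu]_x ((tau / s)%:E * (normal_pdf 0 tau x)%:E))%E).
  apply: ge0_le_integral => //.
  - by move=> x _; rewrite -EFinM lee_fin mulr_ge0 ?normal_fun_ge0 ?normal_pdf_ge0.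
  - apply: emeasurable_funM; apply/measurable_EFinP.
    + exact: measurable_normal_fun.
    + exact: measurable_normal_pdf.
  - apply: emeasurable_funM => //; apply/measurable_EFinP.
    exact: measurable_normal_pdf.
  - move=> x _; rewrite -!EFinM lee_fin normal_fun_pdf ?gt_eqF// mulrAC.
    apply: ler_wpM2r; first exact: normal_pdf_ge0.
    rewrite mulrC ler_pdivrMr ?normal_peak_gt0 ?gt_eqF//.
    rewrite (_ : _ * _ = normal_peak s) ?normal_pdf_ub ?gt_eqF//.
    by rewrite (normal_peakE s)// (normal_peakE tau)//; field; rewrite !gt_eqF.
rewrite integralZl//; last exact: integrable_normal_pdf.
by rewrite integral_normal_pdf mule1.
Qed.

(** With q = (x - m)^2 / (4 s^2), the density of N(m, s^2) is proportional to
    exp(- 2q) and that of N(m, 2 s^2) to exp(- q), so this is q exp(- q) <= 1. *)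
Lemma sqr_normal_pdf_le (m s x : R) : 0 < s ->
  (x - m) ^+ 2 * normal_pdf m s x <=
  4 * Num.sqrt 2 * s ^+ 2 * normal_pdf m (Num.sqrt 2 * s) x.
Proof.
move=> s0; set s' := Num.sqrt 2 * s.
have r2 : 0 < Num.sqrt 2 :> R by rewrite sqrtr_gt0.
have s'0 : 0 < s' by rewrite mulr_gt0.
pose q := (x - m) ^+ 2 / (4 * s ^+ 2).
have sn0 : s != 0 by rewrite gt_eqF.
have pE (z u : R) : 0 < z -> u * (z ^+ 2 *+ 2) = (x - m) ^+ 2 ->
    normal_pdf m z x = z^-1 * normal_peak 1 * expR (- u).
  move=> z0 uE; rewrite normal_pdfE ?gt_eqF// -normal_peakE//.
  congr (_ * expR _); rewrite -uE mulNr mulfK//.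
  by rewrite mulrn_eq0/= sqrf_eq0 gt_eqF.
rewrite (pE s (q + q))//; last by rewrite /q -mulr_natr; field.
rewrite (pE s' q)//; last first.
  by rewrite /q /s' exprMn sqr_sqrtr// -mulr_natr; field.
have -> : (x - m) ^+ 2 = 4 * s ^+ 2 * q by rewrite /q; field.
have q1 : q * expR (- q) <= 1.
  rewrite expRN ler_pdivrMr ?expR_gt0// mul1r.
  by apply: le_trans (expR_ge1Dx q); rewrite lerDr.
rewrite opprD expRD /s'.
rewrite [leLHS](_ : _ = 4 * s * normal_peak 1 * expR (- q) * (q * expR (- q))); last by field.
rewrite [leRHS](_ : _ = 4 * s * normal_peak 1 * expR (- q)); last first.
  by field; rewrite sn0 gt_eqF.
rewrite ler_piMr// mulr_ge0 ?expR_ge0// mulr_ge0 ?normal_peak_ge0//.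
by rewrite mulr_ge0// ltW.
Qed.

Lemma gaussian_moment2_le (m s : R) : 0 < s ->
  (\int[normal_prob m s]_x ((x - m) ^+ 2)%:E <= (4 * Num.sqrt 2 * s ^+ 2)%:E)%E.
Proof.
move=> s0; set s' := Num.sqrt 2 * s.
have s'0 : 0 < s' by rewrite mulr_gt0// sqrtr_gt0.
have ms : measurable_fun setT (fun x : R => ((x - m) ^+ 2)%:E).
  by apply/measurable_EFinP; apply: measurable_funX; exact: measurable_funB.
rewrite ge0_integral_normal_prob//; last by move=> x; rewrite lee_fin sqr_ge0.
apply: (@le_trans _ _ (\int[mu]_x ((4 * Num.sqrt 2 * s ^+ 2)%:E * (normal_pdf m s' x)%:E))%E).
  apply: ge0_le_integral => //.
  - by move=> x _; rewrite -EFinM lee_fin mulr_ge0 ?sqr_ge0 ?normal_pdf_ge0.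
  - apply: emeasurable_funM => //; apply/measurable_EFinP.
    exact: measurable_normal_pdf.
  - apply: emeasurable_funM => //; apply/measurable_EFinP.
    exact: measurable_normal_pdf.
  - by move=> x _; rewrite -!EFinM lee_fin sqr_normal_pdf_le.
rewrite integralZl//; last exact: integrable_normal_pdf.
by rewrite integral_normal_pdf mule1.
Qed.

End Gaussian.

(** * Almost sure convergence of Gaussian variables *)

Section Process.
Context {R : realType} (d : measure_display) (T : measurableType d)
  (P : probability T R).

Lemma Lfun2_of_integral (f : T -> R) : measurable_fun setT f ->
  (\int[P]_w ((f w) ^+ 2)%:E < +oo)%E -> f \in Lfun P 2%:E.
Proof.
move=> mf fi; rewrite inE; apply/andP; split; rewrite inE//=.
rewrite /finite_norm unlock poweR_lty//.
apply: le_lt_trans fi; rewrite le_eqVlt; apply/orP; left; apply/eqP.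
by apply: eq_integral => w _; rewrite /= powR_mulrn// real_normK// num_real.
Qed.

Lemma covariance_Lfun2 (X : {RV P >-> R}) (v : R) :
  ('E_P[X] = 0)%E -> covariance P X X = v%:E -> (X : T -> R) \in Lfun P 2%:E.
Proof.
move=> E0; rewrite unlock E0 /= unlock => cv.
apply: Lfun2_of_integral; first exact: measurable_funP.
suff -> : (\int[P]_w ((X w) ^+ 2)%:E = v%:E)%E by rewrite ltry.
by rewrite -cv; apply: eq_integral => w _ /=; rewrite !fctE /= subr0.
Qed.

(** The variance is the least second moment about a point.  This is for the point m
    that is the first parameter of the normal law of Y. *)
Lemma variance_le_moment2 (Y : T -> R) (m v : R) : Y \in Lfun P 2%:E ->
  covariance P Y Y = v%:E -> (v%:E <= \int[P]_w ((Y w - m) ^+ 2)%:E)%E.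
Proof.
move=> Y2 <-; rewrite -[leLHS](varianceB_cst_r m Y2).
have Pfin : P setT \is a fin_num := fin_num_measure P _ measurableT.
have Ym2 : (Y \- cst m)%R \in Lfun P 2%:E by rewrite rpredB ?lee1n//= Lfun_cst.
rewrite varianceE//.
have fE : ('E_P[(Y \- cst m)%R])%E \is a fin_num.
  by apply: expectation_fin_num; exact: Lfun_subset12.
rewrite [X in (_ <= X)%E](_ : _ = 'E_P[((Y \- cst m) ^+ 2)%R])%E; last by rewrite unlock.
rewrite leeBlDr; last by rewrite fin_numX.
by rewrite leeDl// -(fineK fE) -EFin_expe lee_fin sqr_ge0.
Qed.

(** The hypothesis on the test function forces s < 2 tau for the standard deviation
    s of Y, by [gaussian_test_le]; then [gaussian_moment2_le] bounds the variance. *)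
Lemma gaussian_variance_le (Y : {RV P >-> R}) (v tau : R) :
  gaussian_rv P Y -> (Y : T -> R) \in Lfun P 2%:E -> covariance P Y Y = v%:E ->
  0 < tau ->
  ((2^-1)%:E < \int[P]_w (normal_fun 0 tau (Y w))%:E)%E ->
  v <= 16 * Num.sqrt 2 * tau ^+ 2.
Proof.
move=> [m [s [s0 law]]] Y2 cv tau0 test.
(* [normal_prob] is a measure on [measurableTypeR R], so Y is viewed as a random
   variable with values there. *)
have mY : @measurable_fun _ _ T (measurableTypeR R) setT Y := measurable_funP Y.
pose Y' : {RV P >-> measurableTypeR R} :=
  MeasurableFun.Pack (MeasurableFun.Class (isMeasurableFun.Build _ _ _ _ _ mY)).
have law' (A : set (measurableTypeR R)) : measurable A ->
  distribution P Y' A = if s == 0 then \d_m A else normal_prob m s A.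
  by move=> mA; rewrite -law.
have vle := variance_le_moment2 _ m _ Y2 cv.
rewrite -lee_fin; apply: le_trans vle _.
have mq : @measurable_fun _ _ (measurableTypeR R) _ setT (fun y : R => ((y - m) ^+ 2)%:E).
  by apply/measurable_EFinP; apply: measurable_funX; exact: measurable_funB.
have mt : @measurable_fun _ _ (measurableTypeR R) _ setT
    (fun y : R => (normal_fun 0 tau y)%:E).
  by apply/measurable_EFinP; exact: measurable_normal_fun.
rewrite -(ge0_integral_distribution Y' mq); last first.
  by move=> y; rewrite lee_fin sqr_ge0.
move: test; rewrite -(ge0_integral_distribution Y' mt); last first.
  by move=> y; rewrite lee_fin normal_fun_ge0.
have [s00 _|sn0] := eqVneq s 0.
  rewrite (@eq_measure_integral _ (measurableTypeR R) R _
    (@dirac _ (measurableTypeR R) m R) (distribution P Y')); last first.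
    by move=> A mA _; have := law' A mA; rewrite s00 eqxx.
  rewrite integral_dirac// diracT mul1e subrr expr0n/=.
  by rewrite lee_fin mulr_ge0 ?sqr_ge0// mulr_ge0// sqrtr_ge0.
have {}s0 : 0 < s by rewrite lt_neqAle eq_sym sn0.
rewrite !(@eq_measure_integral _ _ _ _ (normal_prob m s) (distribution P Y')); try by
  move=> A mA _; have := law' A mA; rewrite (negbTE sn0).
move=> /lt_le_trans/(_ (gaussian_test_le m s tau s0 tau0)).
rewrite lte_fin ltr_pdivlMr// mulrC ltr_pdivrMr// => st.
apply: le_trans (gaussian_moment2_le m s s0) _.
rewrite lee_fin.
have : s ^+ 2 <= (tau * 2) ^+ 2.
  by rewrite ler_pXn2r ?nnegrE ?ltW// mulr_gt0.
have : 0 <= Num.sqrt 2 :> R by rewrite sqrtr_ge0.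
nra.
Qed.

(** The test functions [normal_fun 0 tau] are continuous, bounded by 1 and equal to 1
    at 0, so their expectations at Y n tend to 1 by dominated convergence; tau is
    chosen to make the bound of [gaussian_variance_le] equal to e. *)
Lemma gaussian_variance_cvg (Y : nat -> {RV P >-> R}) (v : nat -> R) :
  (forall n, gaussian_rv P (Y n)) ->
  (forall n, (Y n : T -> R) \in Lfun P 2%:E) ->
  (forall n, covariance P (Y n) (Y n) = (v n)%:E) ->
  {ae P, forall w, Y n w @[n --> \oo] --> (0 : R)} ->
  v n @[n --> \oo] --> (0 : R).
Proof.
move=> gY Y2 cv Y0.
have v0 n : 0 <= v n by rewrite -lee_fin -cv; exact: variance_ge0.
apply/cvgrPdist_le => e e0.
pose tau := Num.sqrt (e / (16 * Num.sqrt 2)).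
have r2 : 0 < Num.sqrt 2 :> R by rewrite sqrtr_gt0.
have e'0 : 0 < e / (16 * Num.sqrt 2) by rewrite divr_gt0// mulr_gt0.
have tau0 : 0 < tau by rewrite sqrtr_gt0.
have tauE : 16 * Num.sqrt 2 * tau ^+ 2 = e.
  by rewrite /tau sqr_sqrtr 1?ltW// mulrC divfK// gt_eqF// mulr_gt0.
have mt : measurable_fun setT (normal_fun 0 tau) by exact: measurable_normal_fun.
have ct : continuous (normal_fun 0 tau).
  move=> x; apply: (cvg_comp _ expR); last exact: continuous_expR.
  apply: cvgM; last exact: cvg_cst.
  apply: cvgN; apply: (cvg_comp (fun x => x - 0) (fun x => x ^+ 2)).
    by apply: cvgB; [exact: cvg_id|exact: cvg_cst].
  exact: sqr_continuous.
have t1 : normal_fun 0 tau 0 = 1.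
  by rewrite /normal_fun subrr expr0n/= oppr0 mul0r expR0.
have mtY n : measurable_fun setT (fun w => (normal_fun 0 tau (Y n w))%:E).
  by apply/measurable_EFinP; apply: measurableT_comp.
have cvgtY : {ae P, forall w, [set: T] w ->
    (normal_fun 0 tau (Y n w))%:E @[n --> \oo] --> 1%E}.
  apply: filterS Y0 => w Yw _; rewrite -t1; apply: cvg_EFin; first exact: nearW.
  by apply: (cvg_comp _ _ Yw); exact: ct.
have letY : {ae P, forall w n, [set: T] w ->
    (`|(normal_fun 0 tau (Y n w))%:E| <= 1)%E}.
  apply: aeW => w n _; rewrite lee_fin ger0_norm ?normal_fun_ge0//.
  rewrite -expR0 ler_expR mulNr oppr_le0 mulr_ge0 ?sqr_ge0// invr_ge0.
  by rewrite mulrn_wge0// sqr_ge0.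
have i1 : P.-integrable setT (cst 1%E) by exact: finite_measure_integrable_cst.
have [_ _] := dominated_convergence measurableT mtY (measurable_cst _) cvgtY i1 letY.
rewrite integral_cst// mul1e [X in _ --> X]probability_setT.
move=> Ecvg.
have : \forall n \near \oo, ((2^-1)%:E < \int[P]_w (normal_fun 0 tau (Y n w))%:E)%E.
  apply: (Ecvg (fun u => ((2^-1)%:E < u)%E)); apply: open_ereal_gt'.
  by rewrite lte_fin invf_lt1// ltr1n.
apply: filterS => n tn; rewrite sub0r normrN ger0_norm// -tauE.
exact: gaussian_variance_le (gY n) (Y2 n) (cv n) tau0 tn.
Qed.

End Process.

(** * Continuity of covariance kernels *)

Section Kernel.
Context {R : realType}.

Definition psd_form (k : R3 R -> R3 R -> R) {n} (x : 'I_n -> R3 R) (a b : 'I_n -> R) : R :=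
  \sum_i \sum_j a i * b j * k (x i) (x j).

(** The form is nonnegative on all combinations u a + v b.  The choice u = C,
    v = - B gives the inequality when C > 0; when C = 0, the combination with
    u = 1 and v = - (A + 1) / (2 B) shows that B = 0. *)
Lemma psd_Cauchy_Schwarz (k : R3 R -> R3 R -> R) n (x : 'I_n -> R3 R)
    (a b : 'I_n -> R) : psd_fun k ->
  psd_form k x a b ^+ 2 <= psd_form k x a a * psd_form k x b b.
Proof.
move=> [ksym kpos]; set A := psd_form k x a a.
set B := psd_form k x a b; set C := psd_form k x b b.
have Q u v : 0 <= u ^+ 2 * A + 2 * u * v * B + v ^+ 2 * C.
  have := kpos n x (fun i => u * a i + v * b i).
  suff -> : \sum_i \sum_j (u * a i + v * b i) * (u * a j + v * b j) * k (x i) (x j) =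
      u ^+ 2 * A + 2 * u * v * B + v ^+ 2 * C by [].
  have BE : B = \sum_i \sum_j b i * a j * k (x i) (x j).
    rewrite /B /psd_form exchange_big; apply: eq_bigr => i _; apply: eq_bigr => j _.
    by rewrite ksym [a j * _]mulrC.
  have -> : 2 * u * v * B = u * v * B + u * v * B by ring.
  rewrite {2}BE /A /B /C /psd_form.
  rewrite !mulr_sumr -!big_split; apply: eq_bigr => i _ /=.
  rewrite !mulr_sumr -!big_split; apply: eq_bigr => j _ /=.
  by ring.
have C0 : 0 <= C by have := Q 0 1; rewrite expr0n expr1n/=; lra.
have [C1|C1] := eqVneq C 0; last first.
  have {}C0 : 0 < C by rewrite lt_neqAle eq_sym C1.
  have := Q C (- B).
  rewrite (_ : _ + _ = C * (A * C - B ^+ 2)); last by ring.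
  by rewrite pmulr_rge0// subr_ge0.
have [B0|B0] := eqVneq B 0; first by rewrite B0 C1 mulr0 expr0n.
have := Q 1 (- (A + 1) / (2 * B)).
rewrite C1 (_ : _ + _ = -1) ?ler0N1//.
by field.
Qed.

(** The variance of X_x - X_y when X is a centered process of covariance k. *)
Definition increment_variance (k : R3 R -> R3 R -> R) (x y : R3 R) : R :=
  k x x + k y y - 2 * k x y.

(** E X_x X_y - E X_x' X_y' = E D D' + E D X_y' + E D' X_x' with D = X_x - X_x' and
    D' = X_y - X_y'; each term is bounded by the Cauchy-Schwarz inequality. *)
Lemma psd_increment_le (k : R3 R -> R3 R -> R) (x y x' y' : R3 R) : psd_fun k ->
  `|k x y - k x' y'| <=
    Num.sqrt (increment_variance k x x' * increment_variance k y y')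
    + Num.sqrt (increment_variance k x x' * k y' y')
    + Num.sqrt (increment_variance k y y' * k x' x').
Proof.
move=> kpsd; have ksym := kpsd.1.
pose pt (i : 'I_4) := [:: x; x'; y; y']`_i.
pose dx (i : 'I_4) : R := [:: 1; -1; 0; 0]`_i.
pose dy (i : 'I_4) : R := [:: 0; 0; 1; -1]`_i.
pose ex (i : 'I_4) : R := [:: 0; 1; 0; 0]`_i.
pose ey (i : 'I_4) : R := [:: 0; 0; 0; 1]`_i.
have gE (a b : 'I_4 -> R) : psd_form k pt a b =
    \sum_i \sum_j a i * b j * k (pt i) (pt j) by [].
have CS a b : `|psd_form k pt a b| <= Num.sqrt (psd_form k pt a a * psd_form k pt b b).
  by rewrite -sqrtr_sqr ler_wsqrtr// psd_Cauchy_Schwarz.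
have dxx : psd_form k pt dx dx = increment_variance k x x'.
  rewrite gE !big_ord_recl !big_ord0 /pt /dx /increment_variance /= (ksym x' x); ring.
have dyy : psd_form k pt dy dy = increment_variance k y y'.
  rewrite gE !big_ord_recl !big_ord0 /pt /dy /increment_variance /= (ksym y' y); ring.
have exx : psd_form k pt ex ex = k x' x'.
  rewrite gE !big_ord_recl !big_ord0 /pt /ex /=; ring.
have eyy : psd_form k pt ey ey = k y' y'.
  rewrite gE !big_ord_recl !big_ord0 /pt /ey /=; ring.
have -> : k x y - k x' y' =
    psd_form k pt dx dy + psd_form k pt dx ey + psd_form k pt dy ex.
  rewrite !gE !big_ord_recl !big_ord0 /pt /dx /dy /ex /ey /=.
  rewrite (ksym y x') (ksym y' x'); ring.
rewrite -dxx -dyy -exx -eyy.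
apply: le_trans (ler_normD _ _) _; apply: lerD => //.
by apply: le_trans (ler_normD _ _) _; apply: lerD.
Qed.

End Kernel.

Section KernelContinuity.
Context {R : realType}.

Lemma gaussian_increment_cvg (k : R3 R -> R3 R -> R) (xi : R -> R3 R) (t : R) :
  continuous xi -> gaussian_paths k (fun f => continuous f) ->
  increment_variance k (xi s) (xi t) @[s --> t] --> (0 : R).
Proof.
move=> cxi [d [T [P [X [[gauss mean cov] cX]]]]].
apply/(@cvg_nbhsP _ R^o) => u ut.
have X2 x : (X x : T -> R) \in Lfun P 2%:E by apply: covariance_Lfun2 _ (cov x x); exact: mean.
pose Y n : {RV P >-> R} := (X (xi (u n)) - X (xi t))%R.
have YE n : (Y n : T -> R) = (X (xi (u n)) \- X (xi t))%R by [].
apply: (gaussian_variance_cvg _ _ P Y (fun n => increment_variance k (xi (u n)) (xi t))).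
- move=> n.
  have := gauss 2%N (fun i => if i == ord0 then xi (u n) else xi t)
    (fun i => if i == ord0 then 1 else -1).
  rewrite (_ : (fun w => _) = Y n)//.
  by apply/funext => w; rewrite !big_ord_recl big_ord0 addr0 mul1r mulN1r YE.
- by move=> n; rewrite YE; apply: (@rpredB _ (Lfun P 2%:E)); rewrite ?lee1n.
- move=> n; rewrite YE -/(variance P _) varianceB// /variance !cov /increment_variance.
  by rewrite -EFinM -EFinD.
- apply: filterS cX => w cXw.
  rewrite -(subrr (X (xi t) w)); under eq_fun do rewrite YE.
  apply: cvgB; last exact: cvg_cst.
  apply: (cvg_comp (fun n => xi (u n)) (fun x => X x w)); last exact: cXw.
  by apply: (cvg_comp _ _ ut); exact: cxi.
Qed.

(** The variances of the increments along the curve xi tend to 0, hence so do the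
    three terms of the bound [psd_increment_le]. *)
Lemma gaussian_kernel_continuous (k : R3 R -> R3 R -> R) (xi : R -> R3 R) :
  psd_fun k -> continuous xi -> gaussian_paths k (fun f => continuous f) ->
  continuous (fun p : R * R => k (xi p.1) (xi p.2)).
Proof.
move=> kpsd cxi paths [s t].
have c1 : increment_variance k (xi p.1) (xi s) @[p --> (s, t)] --> (0 : R).
  apply: (cvg_comp fst (fun s' => increment_variance k (xi s') (xi s))); first exact: cvg_fst.
  exact: gaussian_increment_cvg.
have c2 : increment_variance k (xi p.2) (xi t) @[p --> (s, t)] --> (0 : R).
  apply: (cvg_comp snd (fun t' => increment_variance k (xi t') (xi t))); first exact: cvg_snd.
  exact: gaussian_increment_cvg.
have sq0 (f g : R * R -> R) (l : R) : f p @[p --> (s, t)] --> (0 : R) ->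
    g p @[p --> (s, t)] --> l ->
    Num.sqrt (f p * g p) @[p --> (s, t)] --> (0 : R).
  move=> f0 gl; rewrite -(@sqrtr0 R) -(mul0r l).
  apply: (cvg_comp (fun p => f p * g p) Num.sqrt); last exact: sqrt_continuous.
  exact: cvgM.
pose B (p : R * R) :=
  Num.sqrt (increment_variance k (xi p.1) (xi s) * increment_variance k (xi p.2) (xi t)) +
  Num.sqrt (increment_variance k (xi p.1) (xi s) * k (xi t) (xi t)) +
  Num.sqrt (increment_variance k (xi p.2) (xi t) * k (xi s) (xi s)).
have B0 : B p @[p --> (s, t)] --> (0 : R).
  rewrite -[X in _ --> X](addr0 0) -[X in _ --> X + _](addr0 0).
  apply: cvgD; first apply: cvgD.
  - exact: sq0 c1 c2.
  - by apply: sq0 c1 _; exact: cvg_cst.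
  - by apply: sq0 c2 _; exact: cvg_cst.
have : k (xi p.1) (xi p.2) - k (xi s) (xi t) @[p --> (s, t)] --> (0 : R).
  apply: norm_cvg0; apply: (squeeze_cvgr _ (cvg_cst 0) B0).
  by apply: nearW => p; rewrite normr_ge0 /=; exact: psd_increment_le.
by move/subr_cvg0.
Qed.

End KernelContinuity.

(** * Spherical means of radial functions and kernels *)

Section Waves.
Context {R : realType}.

Lemma enorm_sub_sph (w : R3 R) (rho th phi : R) :
  enorm (w - rho *: sph th phi) ^+ 2 =
  enorm w ^+ 2 + rho ^+ 2 - 2 * rho * \sum_i w 0 i * sph th phi 0 i.
Proof.
have sq (y : R3 R) : enorm y ^+ 2 = \sum_i y 0 i ^+ 2.
  by rewrite /enorm sqr_sqrtr//; apply: sumr_ge0 => i _; exact: sqr_ge0.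
have u1 : \sum_i sph th phi 0 i ^+ 2 = 1 :> R.
  rewrite !big_ord_recl big_ord0 !mxE /=.
  transitivity (sin th ^+ 2 * (cos phi ^+ 2 + sin phi ^+ 2) + cos th ^+ 2).
    by ring.
  by rewrite cos2Dsin2 mulr1 addrC cos2Dsin2.
rewrite !sq -[in rho ^+ 2](mulr1 rho) exprMn expr1n -[X in rho ^+ 2 * X]u1.
rewrite !mulr_sumr -!big_split -sumrB /=; apply: eq_bigr => i _.
rewrite !mxE; ring.
Qed.

Lemma odd_part_sg (F : R -> R) (t : R) :
  F t - F (- t) = Num.sg t * (F `|t| - F (- `|t|)).
Proof.
have [t0|t0|->] := ltgtP t 0.
- by rewrite ltr0_norm// ltr0_sg// opprK mulN1r opprB.
- by rewrite gtr0_norm// gtr0_sg// mul1r.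
- by rewrite normr0 oppr0 subrr mulr0.
Qed.

Lemma even_part_norm (F : R -> R) (t : R) :
  F t + F (- t) = F `|t| + F (- `|t|).
Proof.
have [t0|t0] := leP 0 t; first by rewrite ger0_norm.
by rewrite ltr0_norm// opprK addrC.
Qed.

(** Archimedes' theorem for the ridge function g, whose antiderivative G comes from
    the affine substitution s -> r^2 + rho^2 - 2 rho s.  Passing from |t| to t on the
    right uses that it is odd in t. *)
Lemma waveF_radial (c t : R) (w : R3 R) (h : R -> R) :
  0 < c -> enorm w != 0 -> continuous h ->
  waveF c t (fun y => h (enorm (w - y) ^+ 2)) =
  (4 * c * enorm w)^-1 *
  (antideriv h ((enorm w + c * t) ^+ 2) - antideriv h ((enorm w + - c * t) ^+ 2)).
Proof.
move=> c0 r0 ch; rewrite /waveF; set r := enorm w in r0 *; set H := antideriv h.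
have [->|t0] := eqVneq t 0; first by rewrite mul0r !mulr0 subrr mulr0.
set rho := c * `|t|.
have rho0 : 0 < rho by rewrite mulr_gt0// normr_gt0.
pose g s := h (r ^+ 2 + rho ^+ 2 - 2 * rho * s).
pose G s := - (2 * rho)^-1 * H (r ^+ 2 + rho ^+ 2 - 2 * rho * s).
have dH (x : R) : is_derive x 1 H (h x) by exact: is_derive_antideriv.
have dG (x : R) : is_derive x 1 G (g x).
  apply: is_derive_eq; rewrite /GRing.scale /= /g; field.
  by rewrite gt_eqF.
have cg : continuous g by rewrite /g; cont.
rewrite (_ : sphere_int _ = sphere_int (fun gam => g (\sum_i w 0 i * gam 0 i))); last first.
  apply: eq_Rintegral => th _; apply: eq_Rintegral => phi _.
  by rewrite enorm_sub_sph.
have pi0 : pi != 0 :> R by rewrite gt_eqF// pi_gt0.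
have -> : sphere_int (fun gam => g (\sum_i w 0 i * gam 0 i)) =
    r^-1 * (2 * pi * (G r - G (- r))).
  by rewrite -(sphere_int_ridge w _ _ dG cg) mulKf.
have := odd_part_sg (fun t => H ((r + c * t) ^+ 2)) t.
rewrite mulrN -mulNr mulrN -mulNr => ->.
rewrite -/rho /G.
have -> : r ^+ 2 + rho ^+ 2 - 2 * rho * r = (r - rho) ^+ 2 by ring.
have -> : r ^+ 2 + rho ^+ 2 - 2 * rho * - r = (r + rho) ^+ 2 by ring.
have -> : - c * `|t| = - rho by rewrite mulNr.
have tE : t = Num.sg t * (rho / c).
  by rewrite [rho / c]mulrC mulKf ?gt_eqF// -numEsg.
rewrite {1}tE; move: pi pi0 => p p0.
by field; rewrite p0 r0 (gt_eqF c0) (gt_eqF rho0).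
Qed.

Lemma primitive2_antideriv2 (K k0 : R -> R -> R) (a b : R) : 0 <= a -> 0 <= b ->
  (forall s s', 0 <= s -> 0 <= s' -> K s s' = k0 s s') ->
  antideriv2 K a b = primitive2 k0 a b.
Proof.
move=> a0 b0 KE; rewrite /antideriv2 antideriv_ge0//; apply: eq_Rintegral => s.
rewrite inE/= in_itv/= => /andP[s0 _]; rewrite antideriv_ge0//.
by apply: eq_Rintegral => s'; rewrite inE/= in_itv/= => /andP[s'0 _]; exact: KE.
Qed.

Lemma waveFF_radial (K : R -> R -> R) (c t t' : R) (x0 x x' : R3 R)
    (k : R3 R -> R3 R -> R) :
  continuous (fun p : R * R => K p.1 p.2) ->
  0 < c -> enorm (x - x0) != 0 -> enorm (x' - x0) != 0 -> radial x0 k K ->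
  let q (e : R) := (enorm (x - x0) + e * t) ^+ 2 in
  let q' (e : R) := (enorm (x' - x0) + e * t') ^+ 2 in
  waveFF c t t' k x x' =
  (16 * c ^+ 2 * enorm (x - x0) * enorm (x' - x0))^-1 *
  ((antideriv2 K (q c) (q' c) - antideriv2 K (q c) (q' (- c))) -
   (antideriv2 K (q (- c)) (q' c) - antideriv2 K (q (- c)) (q' (- c)))).
Proof.
move=> cK c0 r0 r'0 kK q q'; rewrite /waveFF.
set r := enorm (x - x0) in r0 q *; set r' := enorm (x' - x0) in r'0 q' *.
pose h s := (4 * c * r')^-1 * (antideriv (K s) (q' c) - antideriv (K s) (q' (- c))).
have cA b : continuous (fun s => antideriv (K s) b) by exact: continuous_antideriv_param.
have ch : continuous h by rewrite /h; move: (cA (q' c)) (cA (q' (- c))) => c1 c2; cont.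
have E : (fun y => waveF c t' (fun y' => k (x - y) (x' - y'))) =
    (fun y => h (enorm (x - x0 - y) ^+ 2)).
  apply/funext => y; set s := enorm (x - x0 - y) ^+ 2.
  have cKs : continuous (K s) by exact: continuous_slice.
  transitivity (waveF c t' (fun y' => K s (enorm (x' - x0 - y') ^+ 2))).
    by congr (waveF c t' _); apply/funext => y'; rewrite kK addrAC (addrAC x').
  exact: waveF_radial c0 r'0 cKs.
rewrite E (waveF_radial c t (x - x0) h c0 r0 ch) /h !antideriv_comb//.
have F (a1 a2 a3 a4 : R) : (4 * c * r)^-1 *
    ((4 * c * r')^-1 * (a1 - a2) - (4 * c * r')^-1 * (a3 - a4)) =
    (16 * c ^+ 2 * r * r')^-1 * ((a1 - a2) - (a3 - a4)).
  clear -c0 r0 r'0; move: r r' r0 r'0 => u v u0 v0.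
  by field; rewrite u0 v0 (gt_eqF c0).
exact: F.
Qed.

Lemma is_derive_comp_sqr (F : R -> R) (r e t dF : R) :
  is_derive ((r + e * t) ^+ 2) 1 F dF ->
  is_derive t 1 (fun t => F ((r + e * t) ^+ 2)) (2 * e * (r + e * t) * dF).
Proof.
move=> DF; have D : is_derive t 1 (fun t => (r + e * t) ^+ 2) (2 * e * (r + e * t)).
  by deriv_ring.
have := is_derive_comp_fun F (fun t => (r + e * t) ^+ 2) t _ _ DF D.
by rewrite mulrC.
Qed.

(** The profile k0 is arbitrary at negative arguments.  Reading k along a ray from x0
    at distance [Num.sqrt s], which is 0 for s < 0, extends its restriction to
    nonnegative arguments to a continuous function on the plane. *)
Lemma radial_profile (x0 : R3 R) (k : R3 R -> R3 R -> R) (k0 : R -> R -> R) :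
  psd_fun k -> gaussian_paths k (fun f => continuous f) -> radial x0 k k0 ->
  exists K : R -> R -> R, [/\ continuous (fun p : R * R => K p.1 p.2),
    radial x0 k K & forall s s', 0 <= s -> 0 <= s' -> K s s' = k0 s s'].
Proof.
move=> kpsd kpaths krad.
pose xi (s : R) : R3 R := x0 + Num.sqrt s *: delta_mx 0 0.
have xiE s : 0 <= s -> enorm (xi s - x0) ^+ 2 = s.
  move=> s0; rewrite /xi addrC addKr sqr_enorm !mxE /= mulr1 sqr_sqrtr//.
  have -> : (inord 2 == 0 :> 'I_3) = false by rewrite -val_eqE /= inordK.
  by rewrite !mulr0 expr0n !addr0.
have KE s s' : 0 <= s -> 0 <= s' -> k (xi s) (xi s') = k0 s s'.
  by move=> s0 s'0; rewrite krad !xiE.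
exists (fun s s' => k (xi s) (xi s')); split => //.
- apply: gaussian_kernel_continuous => // s; apply: cvgD; first exact: cvg_cst.
  by apply: cvgZ; [exact: sqrt_continuous|exact: cvg_cst].
- by move=> x x'; rewrite KE ?sqr_ge0.
Qed.

(** The derivative in t' turns the inner antiderivative into values of K, while the
    outer antiderivative remains to be differentiated in t. *)
Lemma is_derive_waveFF_inner (K : R -> R -> R) (c t t' : R) (x0 x x' : R3 R)
    (k : R3 R -> R3 R -> R) :
  continuous (fun p : R * R => K p.1 p.2) ->
  0 < c -> enorm (x - x0) != 0 -> enorm (x' - x0) != 0 -> radial x0 k K ->
  let r := enorm (x - x0) in let r' := enorm (x' - x0) in
  let m s := (r' + c * t') * K s ((r' + c * t') ^+ 2) +
             (r' + - c * t') * K s ((r' + - c * t') ^+ 2) in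
  is_derive t' 1 (fun t' => waveFF c t t' k x x')
    ((8 * c * r * r')^-1 *
     (antideriv m ((r + c * t) ^+ 2) - antideriv m ((r + - c * t) ^+ 2))).
Proof.
move=> cK c0 r0 r'0 kK r r' m.
pose P e e' u := antideriv2 K ((r + e * t) ^+ 2) ((r' + e' * u) ^+ 2).
rewrite (_ : (fun t' => _) = (fun u => (16 * c ^+ 2 * r * r')^-1 *
    ((P c c u - P c (- c) u) - (P (- c) c u - P (- c) (- c) u)))); last first.
  by apply/funext => u; exact: (waveFF_radial K c t u x0 x x' k cK c0 r0 r'0 kK).
have cKb b : continuous (K ^~ b) by exact: continuous_slice_r.
have mE a : antideriv m a =
    (r' + c * t') * antideriv (K ^~ ((r' + c * t') ^+ 2)) a +
    (r' + - c * t') * antideriv (K ^~ ((r' + - c * t') ^+ 2)) a.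
  rewrite /antideriv /m !RintegralD ?RintegralZl//; try apply: continuous_integrable;
    try (apply: continuousM_fun => //; exact: cst_continuous); try exact: cKb.
  by ring.
have D e e' : is_derive t' 1 (P e e')
    (2 * e' * (r' + e' * t') *
     antideriv (K ^~ ((r' + e' * t') ^+ 2)) ((r + e * t) ^+ 2)).
  apply: (is_derive_comp_sqr (antideriv2 K ((r + e * t) ^+ 2))).
  exact: is_derive_antideriv2 cK (sqr_ge0 _).
apply: is_derive_eq; rewrite !mE /GRing.scale /=.
clear -c0 r0 r'0; rewrite -/r -/r' in r0 r'0.
move: (antideriv _ _) (antideriv _ _) (antideriv _ _) (antideriv _ _) => a1 a2 a3 a4.
move: r r' r0 r'0 => u v u0 v0.
by field; rewrite u0 v0 (gt_eqF c0).
Qed.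

Lemma sum_signs (F : R -> R) :
  \sum_(e <- [:: -1; 1]) F e = F (-1) + F 1.
Proof. by rewrite big_cons big_seq1. Qed.

(** The signs of t and t' come out separately, as the left-hand side is odd in each. *)
Lemma odd_part_sg2 (Q : R -> R -> R) (t t' : R) :
  (Q t t' - Q t (- t')) - (Q (- t) t' - Q (- t) (- t')) =
  Num.sg (t * t') * (Q (- `|t|) (- `|t'|) - Q (- `|t|) `|t'|
                     + (- Q `|t| (- `|t'|) + Q `|t| `|t'|)).
Proof.
rewrite (odd_part_sg (Q t) t') (odd_part_sg (Q (- t)) t').
rewrite (odd_part_sg (fun u => Num.sg t' * (Q u `|t'| - Q u (- `|t'|))) t) sgrM.
by ring.
Qed.

Lemma even_part_norm2 (Q : R -> R -> R) (t t' : R) :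
  Q t t' + Q t (- t') + (Q (- t) t' + Q (- t) (- t')) =
  Q (- `|t|) (- `|t'|) + Q (- `|t|) `|t'| + (Q `|t| (- `|t'|) + Q `|t| `|t'|).
Proof.
rewrite (even_part_norm (Q t) t') (even_part_norm (Q (- t)) t').
rewrite (even_part_norm (fun u => Q u `|t'| + Q u (- `|t'|)) t).
by ring.
Qed.

End Waves.

(** * The wave kernels *)

Theorem proposition3p3 (R : realType) (c : R) (x0 : R3 R)
    (kv ku : R3 R -> R3 R -> R) (kv0 ku0 : R -> R -> R)
    (c_gt0 : 0 < c)
    (kv_psd : psd_fun kv) (ku_psd : psd_fun ku)
    (kv_paths : gaussian_paths kv (fun f => continuous f))
    (ku_paths : gaussian_paths ku (fun f => C1 f))
    (kv_radial : radial x0 kv kv0) (ku_radial : radial x0 ku ku0) :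
  forall (x x' : R3 R) (t t' : R),
    let r := enorm (x - x0) in
    let r' := enorm (x' - x0) in
    r != 0 -> r' != 0 ->
    kv_wave c kv (x, t) (x', t') =
      Num.sg (t * t') / (16 * c ^+ 2 * r * r') *
      (\sum_(e <- [:: -1; 1]) \sum_(e' <- [:: -1; 1])
        e * e' * primitive2 kv0 ((r + e * c * `|t|) ^+ 2)
                                ((r' + e' * c * `|t'|) ^+ 2))
    /\ ku_wave_defined c ku (x, t) (x', t')
    /\ ku_wave c ku (x, t) (x', t') =
      1 / (4 * r * r') *
      (\sum_(e <- [:: -1; 1]) \sum_(e' <- [:: -1; 1])
        (r + e * c * `|t|) * (r' + e' * c * `|t'|) *
        ku0 ((r + e * c * `|t|) ^+ 2) ((r' + e' * c * `|t'|) ^+ 2)).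
Proof.
move=> x x' t t' r r' r0 r'0.
have [Kv [cKv rKv KvE]] := radial_profile x0 kv kv0 kv_psd kv_paths kv_radial.
have ku_cpaths : gaussian_paths ku (fun f => continuous f).
  have [d [T [P [X [gX C1X]]]]] := ku_paths.
  exists d, T, P, X; split=> //; apply: filterS C1X => w [dX _] y.
  exact: differentiable_continuous.
have [Ku [cKu rKu KuE]] := radial_profile x0 ku ku0 ku_psd ku_cpaths ku_radial.
split.
  rewrite /kv_wave (waveFF_radial Kv c t t' x0 x x' kv cKv c_gt0 r0 r'0 rKv) /=.
  rewrite -/r -/r'.
  have [Q Qdef] : exists Q : R -> R -> R, forall u u',
    Q u u' = antideriv2 Kv ((r + c * u) ^+ 2) ((r' + c * u') ^+ 2).
    by eexists.
  have QE e e' : antideriv2 Kv ((r + e * c * `|t|) ^+ 2) ((r' + e' * c * `|t'|) ^+ 2)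
      = Q (e * `|t|) (e' * `|t'|) by rewrite Qdef !mulrA ![c * _]mulrC.
  rewrite !sum_signs.
  rewrite -!(primitive2_antideriv2 Kv)//; try exact: sqr_ge0.
  rewrite !QE !mulN1r !mul1r.
  have -> : antideriv2 Kv ((r + - c * t) ^+ 2) ((r' + - c * t') ^+ 2) = Q (- t) (- t').
    by rewrite Qdef !mulNr ?mulrN.
  have -> : antideriv2 Kv ((r + - c * t) ^+ 2) ((r' + c * t') ^+ 2) = Q (- t) t'.
    by rewrite Qdef !mulNr ?mulrN.
  have -> : antideriv2 Kv ((r + c * t) ^+ 2) ((r' + - c * t') ^+ 2) = Q t (- t').
    by rewrite Qdef !mulNr ?mulrN.
  have -> : antideriv2 Kv ((r + c * t) ^+ 2) ((r' + c * t') ^+ 2) = Q t t'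
    by rewrite Qdef.
  have fin (N Y Z s : R) : Y = s * Z -> N^-1 * Y = s / N * Z.
    by move=> ->; rewrite mulrCA mulrA.
  apply: fin; rewrite (odd_part_sg2 Q); congr (_ * _).
  by move: (Q _ _) (Q _ _) (Q _ _) (Q _ _) => a1 a2 a3 a4; ring.
pose m s := (r' + c * t') * Ku s ((r' + c * t') ^+ 2) +
            (r' + - c * t') * Ku s ((r' + - c * t') ^+ 2).
have inner u := is_derive_waveFF_inner Ku c u t' x0 x x' ku cKu c_gt0 r0 r'0 rKu.
rewrite /= -/r -/r' -/m in inner.
have innerE : (fun u => derive1 (fun t' => waveFF c u t' ku x x') t') =
    (fun u => (8 * c * r * r')^-1 *
      (antideriv m ((r + c * u) ^+ 2) - antideriv m ((r + - c * u) ^+ 2))).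
  by apply/funext => u; rewrite derive1E; exact: (@derive_val _ _ _ _ _ _ _ (inner u)).
have cm : continuous m.
  have cKb b : continuous (Ku ^~ b) by exact: continuous_slice_r.
  by rewrite /m; apply: continuousD_fun; apply: continuousM_fun;
    [exact: cst_continuous|exact: cKb|exact: cst_continuous|exact: cKb].
have dm (e : R) : is_derive t 1 (fun u => antideriv m ((r + e * u) ^+ 2))
    (2 * e * (r + e * t) * m ((r + e * t) ^+ 2)).
  apply: (is_derive_comp_sqr (antideriv m)); exact: is_derive_antideriv.
have outer : is_derive t 1 (fun u => (8 * c * r * r')^-1 *
      (antideriv m ((r + c * u) ^+ 2) - antideriv m ((r + - c * u) ^+ 2)))
    ((4 * r * r')^-1 * ((r + c * t) * m ((r + c * t) ^+ 2) +
                        (r + - c * t) * m ((r + - c * t) ^+ 2))).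
  apply: is_derive_eq; rewrite /GRing.scale /=.
  move: (m _) (m _) => m1 m2; clear -c_gt0 r0 r'0.
  move: r r' r0 r'0 => u v u0 v0.
  by field; rewrite u0 v0 (gt_eqF c_gt0).
split; first split.
- by move=> u /=; have [] := inner u.
- by rewrite /= innerE; have [] := outer.
rewrite /ku_wave /= innerE derive1E (@derive_val _ _ _ _ _ _ _ outer).
rewrite !sum_signs /m.
rewrite -!KuE ?sqr_ge0//.
pose S u u' := (r + c * u) * (r' + c * u') * Ku ((r + c * u) ^+ 2) ((r' + c * u') ^+ 2).
have SE e e' : (r + e * c * `|t|) * (r' + e' * c * `|t'|) *
    Ku ((r + e * c * `|t|) ^+ 2) ((r' + e' * c * `|t'|) ^+ 2)
    = S (e * `|t|) (e' * `|t'|) by rewrite /S !mulrA ![c * _]mulrC.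
rewrite [1 / _]mul1r !SE !mulN1r !mul1r; congr (_ * _).
rewrite -(even_part_norm2 S) /S !mulrN !mulNr.
move: (Ku _ _) (Ku _ _) (Ku _ _) (Ku _ _) => a1 a2 a3 a4; ring.
Qed.
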